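(* At full coupling $\gamma=1$, and for every $\theta$, the holistic discretisation given by $$\mathcal TU_j=\frac4{H^2}\operatorname{asinh}^2\left[\sqrt{\frac{\mu_j^2-\tfrac14\theta^2\delta_j^2}{1+\tfrac12\gamma\delta_j^2-\tfrac14\gamma^2(\theta^2+1)\delta_j^2}}\,\frac{\gamma\delta_j}2\right]U_j,$$ equivalently $$\partial_tU_j=\mathcal K_0U_j+\mathcal K\left\{\frac4{H^2}\operatorname{asinh}^2\left[\sqrt{\frac{\mu_j^2-\tfrac14\theta^2\delta_j^2}{1+\tfrac12\gamma\delta_j^2-\tfrac14\gamma^2(\theta^2+1)\delta_j^2}}\,\frac{\gamma\delta_j}2\right]\right\}U_j,$$ is consistent with the evolution equation $u_t=\mathcal K_0u+\mathcal K(\partial_x^2)u$.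
   Context: $\mathbb U$ is a Hilbert space; $\mathbb C:=C^\omega(\mathbb X)$ is the space of smooth $\mathbb U$-valued fields on the (periodic) interval $\mathbb X$. $\mathcal K_k:\mathbb U\to\mathbb U$ are linear operators with $\mathcal K_1$ invertible, and $\mathcal K:\mathbb C\to\mathbb C$ is isotropic and invertible, formally expandable as $\mathcal K=\mathcal K(\partial_x^2)=\sum_{k=1}^\infty\mathcal K_k\partial_x^{2k}$; $\mathcal K\{\mathcal R\}=\sum_{k\ge1}\mathcal K_k\mathcal R^k$. The inverse is in the sense of reverting the operator function: if $A=\mathcal K(\mathcal R)$ then $\mathcal R=\mathcal K^{-1}(A)$; and $\mathcal T:=\mathcal K^{-1}(\partial_t-\mathcal K_0)$. $U_j(t)\in\mathbb U$ are macroscale grid values on a uniform grid of spacing $H$, $\theta$ is real. $E_j^{\pm1}U_j=U_{j\pm1}$; $\delta_j=E_j^{1/2}-E_j^{-1/2}$, $\mu_j=\tfrac12(E_j^{1/2}+E_j^{-1/2})$, $\mu_j^2=1+\tfrac14\delta_j^2$; operator functions are interpreted as power series in the operators. The discretisation arises from posing the evolution equation on equi-sized elements of length $H$ coupled by edge conditions with parameters $\gamma,\theta$. Consistency: interpolate $U_j(t)$ by a smooth field $U(t,x)$ such that one step in $j$ is one step of size $H$ in $x$; thus, acting on the macroscale field, $\delta_j=2\sinh(H\partial_x/2)$, $\mu_j=\cosh(H\partial_x/2)$, $\partial_j=H\partial_x$. Substituting these power series in $\partial_x$ gives the equivalent PDE of the discretisation. The discretisation is consistent with the evolution equation when this equivalent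 PDE is $\partial_tU=\mathcal K_0U+\mathcal K(\partial_x^2)U$ (to all orders in $\partial_x$). *)

(* Defs.v *)
From HB Require Import structures.
From mathcomp Require Import all_boot all_order all_algebra.
From mathcomp Require Import boolp classical_sets reals prodnormedzmodule.
From mathcomp Require Import topology normedtype.

Set Implicit Arguments.
Unset Strict Implicit.
Unset Printing Implicit Defensive.
Import Order.TTheory GRing.Theory Num.Theory.
Local Open Scope ring_scope.

(* An alias is needed because MathComp-Analysis already gives nat -> A its    *)
(* pointwise ring structure; fps A carries the Cauchy product.  A need not be *)
(* commutative (it will be a ring of operators), nor nontrivial.              *)
Definition fps (A : Type) := nat -> A.

Section FormalPowerSeries.
Variable A : pzRingType.
Implicit Types f g h : fps A.

HB.instance Definition _ := gen_eqMixin (fps A).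
HB.instance Definition _ := gen_choiceMixin (fps A).

Lemma fpsP f g : (forall n, f n = g n) -> f = g.
Proof. by move=> fg; apply/funext. Qed.

Definition fps_add f g : fps A := fun n => f n + g n.
Definition fps_opp f : fps A := fun n => - f n.
Definition fpsC (a : A) : fps A := fun n => if n is 0 then a else 0.
Definition fps_mul f g : fps A := fun n => \sum_(i < n.+1) f i * g (n - i)%N.

Fact fps_addA : associative fps_add.
Proof. by move=> f g h; apply: fpsP => n; rewrite /fps_add addrA. Qed.
Fact fps_addC : commutative fps_add.
Proof. by move=> f g; apply: fpsP => n; rewrite /fps_add addrC. Qed.
Fact fps_add0 : left_id (fpsC 0) fps_add.
Proof. by move=> f; apply: fpsP => -[|n]; rewrite /fps_add add0r. Qed.
Fact fps_addN : left_inverse (fpsC 0) fps_opp fps_add.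
Proof. by move=> f; apply: fpsP => -[|n]; rewrite /fps_add addNr. Qed.

HB.instance Definition _ :=
  GRing.isZmodule.Build (fps A) fps_addA fps_addC fps_add0 fps_addN.

Lemma fps_mul_rev f g n :
  fps_mul f g n = \sum_(i < n.+1) f (n - i)%N * g i.
Proof.
rewrite /fps_mul (reindex_inj rev_ord_inj) /=.
by apply: eq_bigr => i _; rewrite subSS subKn // -ltnS.
Qed.

Fact fps_mulA : associative fps_mul.
Proof.
move=> p q r; apply: fpsP => i; rewrite {1}/fps_mul fps_mul_rev.
pose coef3 j k := p j * (q (i - j - k)%N * r k).
transitivity (\sum_(j < i.+1) \sum_(k < i.+1 | (k <= i - j)%N) coef3 j k).
  apply: eq_bigr => /= j _; rewrite fps_mul_rev big_distrr /=.
  by rewrite (big_ord_narrow_leq (leq_subr _ _)).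
rewrite (exchange_big_dep predT) //=; apply: eq_bigr => k _.
transitivity (\sum_(j < i.+1 | (j <= i - k)%N) coef3 j k).
  apply: eq_bigl => j; rewrite -ltnS -(ltnS j) -!subSn ?leq_ord //.
  by rewrite -subn_gt0 -(subn_gt0 j) -!subnDA addnC.
rewrite (big_ord_narrow_leq (leq_subr _ _)) /fps_mul big_distrl /=.
by apply: eq_bigr => j _; rewrite /coef3 -!subnDA addnC mulrA.
Qed.

Fact fps_mul1 : left_id (fpsC 1) fps_mul.
Proof.
move=> f; apply: fpsP => n; rewrite /fps_mul big_ord_recl /= mul1r subn0.
by rewrite big1 ?addr0 // => i _; rewrite mul0r.
Qed.
Fact fps_mulr1 : right_id (fpsC 1) fps_mul.
Proof.
move=> f; apply: fpsP => n; rewrite fps_mul_rev big_ord_recl /= mulr1 subn0.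
by rewrite big1 ?addr0 // => i _; rewrite mulr0.
Qed.
Fact fps_mulDl : left_distributive fps_mul fps_add.
Proof.
move=> f g h; apply: fpsP => n; rewrite /fps_mul /fps_add -big_split /=.
by apply: eq_bigr => i _; rewrite mulrDl.
Qed.
Fact fps_mulDr : right_distributive fps_mul fps_add.
Proof.
move=> f g h; apply: fpsP => n; rewrite /fps_mul /fps_add -big_split /=.
by apply: eq_bigr => i _; rewrite mulrDr.
Qed.

HB.instance Definition _ := GRing.Zmodule_isPzRing.Build (fps A)
  fps_mulA fps_mul1 fps_mulr1 fps_mulDl fps_mulDr.

Definition fpsX : fps A := fun n => if n is 1 then 1 else 0.

(* F(g) = \sum_k F_k g^k, coefficients on the left.  Truncating the sum at    *)
(* k = n is exact when g has no constant term, the only case used below.      *)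
Definition fps_comp (F g : fps A) : fps A :=
  fun n => \sum_(k < n.+1) F k * (g ^+ k) n.

End FormalPowerSeries.

Arguments fpsX {A}.
Reserved Notation "c %:S" (at level 1, left associativity, format "c %:S").
Notation "c %:S" := (fpsC c) : ring_scope.
Notation "F \oS g" := (fps_comp F g) (at level 45, left associativity) : ring_scope.

Section ElementarySeries.
Variable R : realType.
Implicit Types a : fps R.

Definition sinh_fps : fps R := fun n => if odd n then (n`!%:R)^-1 else 0.

(* asinh z = \sum_m (-1)^m (2m)! / (4^m (m!)^2 (2m+1)) z^(2m+1) *)
Definition asinh_fps : fps R := fun n =>
  if odd n then
    (-1) ^+ n./2 * (n.-1)`!%:R / (4 ^+ n./2 * (n./2)`!%:R ^+ 2 * n%:R)
  else 0.

(* 1/(1+z) and sqrt(1+z), the latter by the binomial series *)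
Definition inv1p_fps : fps R := fun n => (-1) ^+ n.
Definition sqrt1p_fps : fps R :=
  fun n => (\prod_(i < n) (2^-1 - i%:R)) / n`!%:R.

(* Meaningful for series with constant term 1. *)
Definition fps_inv a : fps R := inv1p_fps \oS (a - 1).
Definition fps_sqrt a : fps R := sqrt1p_fps \oS (a - 1).

End ElementarySeries.

Arguments sinh_fps {R}.
Arguments asinh_fps {R}.

(* The ring of linear operators U -> U, with composition as product. *)
Definition lend (R : comNzRingType) (U : lmodType R) := {linear U -> U}.

Section OperatorRing.
Variables (R : comNzRingType) (U : lmodType R).
Implicit Types f g h : lend U.

HB.instance Definition _ := Choice.copy (lend U) {linear U -> U}.

Lemma lendP f g : (forall u, f u = g u) -> f = g.
Proof.
case: f g => [f [[f0] [f1]]] [g [[g0] [g1]]] /= /funext fg.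
by subst g; rewrite (Prop_irrelevance f0 g0) (Prop_irrelevance f1 g1).
Qed.

Definition lend_zero : lend U := \0 : {linear U -> U}.
Definition lend_add f g : lend U :=
  GRing.add_fun (f : {linear U -> U}) (g : {linear U -> U}) : {linear U -> U}.
Definition lend_opp f : lend U :=
  GRing.opp_fun (f : {linear U -> U}) : {linear U -> U}.
Definition lend_one : lend U := idfun : {linear U -> U}.
Definition lend_mul f g : lend U :=
  (f : {linear U -> U}) \o (g : {linear U -> U}) : {linear U -> U}.
Definition scal_op (a : R) : lend U := GRing.scale a : {linear U -> U}.

Fact lend_addA : associative lend_add.
Proof. by move=> f g h; apply: lendP => u /=; rewrite addrA. Qed.
Fact lend_addC : commutative lend_add.
Proof. by move=> f g; apply: lendP => u /=; rewrite addrC. Qed.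
Fact lend_add0 : left_id lend_zero lend_add.
Proof. by move=> f; apply: lendP => u /=; rewrite add0r. Qed.
Fact lend_addN : left_inverse lend_zero lend_opp lend_add.
Proof. by move=> f; apply: lendP => u /=; rewrite addNr. Qed.

HB.instance Definition _ :=
  GRing.isZmodule.Build (lend U) lend_addA lend_addC lend_add0 lend_addN.

Fact lend_mulA : associative lend_mul.
Proof. by move=> f g h; apply: lendP. Qed.
Fact lend_mul1 : left_id lend_one lend_mul.
Proof. by move=> f; apply: lendP. Qed.
Fact lend_mulr1 : right_id lend_one lend_mul.
Proof. by move=> f; apply: lendP. Qed.
Fact lend_mulDl : left_distributive lend_mul lend_add.
Proof. by move=> f g h; apply: lendP. Qed.
Fact lend_mulDr : right_distributive lend_mul lend_add.
Proof. by move=> f g h; apply: lendP => u /=; rewrite linearD. Qed.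

HB.instance Definition _ := GRing.Zmodule_isPzRing.Build (lend U)
  lend_mulA lend_mul1 lend_mulr1 lend_mulDl lend_mulDr.

(* A scalar series sum_n f_n D^n read as the operator series                  *)
(* sum_n (f_n id) D^n.                                                        *)
Definition scal_fps (f : fps R) : fps (lend U) := fun n => scal_op (f n).

End OperatorRing.

Section Consistency.
Variables (R : realType) (U : lmodType R).
(* K 0 is the operator K_0; the K k with k >= 1 are the coefficients of the   *)
(* operator function K.                                                       *)
Variable K : nat -> {linear U -> U}.
(* Spacing H of the grid, coupling gamma, edge parameter theta. *)
Variables (H gamma theta : R).

Definition K0 : fps (lend U) := fpsC (K 0%N : lend U).

(* K(z) = \sum_(k >= 1) K_k z^k, so that K{r} is Kfun \oS r and the operator  *)
(* K(partial_x^2) is Kfun \oS fpsX ^+ 2.                                      *)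
Definition Kfun : fps (lend U) := fun k => if k is 0 then 0 else K k.

(* The series r without constant term such that K{r} = a.  When K_1 is        *)
(* invertible it exists and is unique for every a without constant term; the  *)
(* value 0 is a dummy for the other cases.                                    *)
Definition Kinv (a : fps (lend U)) : fps (lend U) :=
  xget 0 [set r : fps (lend U) | r 0%N = 0 /\ Kfun \oS r = a]%classic.

(* A law  partial_t U_j = \sum_n G_n delta_j^n U_j  on the grid is given by   *)
(* its series G in delta_j, and a law  partial_t U = \sum_n P_n partial_x^n U *)
(* on fields by its series P in partial_x.                                    *)

(* In terms of delta_j: mu_j^2 = 1 + delta_j^2 / 4. *)
Definition delta : fps R := fpsX.
Definition mu : fps R := fps_sqrt (1 + (4^-1)%:S * delta ^+ 2).

Definition holistic_op : fps R :=
  (4 / H ^+ 2)%:S *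
  (asinh_fps \oS
     (fps_sqrt
        ((mu ^+ 2 - (4^-1 * theta ^+ 2)%:S * delta ^+ 2) *
         fps_inv (1 + (2^-1 * gamma)%:S * delta ^+ 2
                    - (4^-1 * gamma ^+ 2 * (theta ^+ 2 + 1))%:S * delta ^+ 2)) *
      ((gamma / 2)%:S * delta))) ^+ 2.

(* T U_j = holistic_op U_j with T = K^{-1}(partial_t - K_0), for the law G:   *)
(* on its solutions partial_t is the operator G.                              *)
Definition holistic_T_form (G : fps (lend U)) : Prop :=
  Kinv (G - K0) = scal_fps U holistic_op.

(* The right-hand side of the explicit form. *)
Definition holistic_rhs : fps (lend U) := K0 + (Kfun \oS scal_fps U holistic_op).

(* Substitution of delta_j = 2 sinh(H partial_x / 2).  This turns mu_j into   *)
(* cosh(H partial_x / 2), since mu_j is a series in delta_j.                  *)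
Definition delta_x : fps R := 2%:S * (sinh_fps \oS ((H / 2)%:S * fpsX)).
Definition equivalent_pde (G : fps (lend U)) : fps (lend U) :=
  G \oS scal_fps U delta_x.

Definition evolution_rhs : fps (lend U) := K0 + (Kfun \oS (fpsX ^+ 2)).

Definition consistent (G : fps (lend U)) : Prop :=
  equivalent_pde G = evolution_rhs.

End Consistency.

(* Main.v *)
Require Import Defs.
From HB Require Import structures.
From mathcomp Require Import all_boot all_order all_algebra.
From mathcomp Require Import boolp classical_sets reals prodnormedzmodule.
From mathcomp Require Import topology normedtype.
From mathcomp Require Import ring.

Set Implicit Arguments.
Unset Strict Implicit.
Unset Printing Implicit Defensive.
Import Order.TTheory GRing.Theory Num.Theory.
Import numFieldNormedType.Exports.
Local Open Scope ring_scope.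

(** With gamma = 1 and mu^2 = 1 + delta^2/4, numerator and denominator under the
    square root are both 1 + (1 - theta^2) delta^2 / 4, so theta drops out and
    the operator is 4/H^2 asinh^2(delta/2).  Substituting
    delta = 2 sinh(H d_x / 2) turns it into d_x^2, because asinh o sinh = id as
    formal series: asinh' satisfies (1 + z^2) A' + z A = 0, whence
    (A o sinh) cosh is constant.  The two forms of the law agree because
    K_1 is injective, so that K{r} determines r. *)

(** * Composition of formal power series over a possibly noncommutative ring *)

Section Composition.
Variable A : pzRingType.
Implicit Types (f g h : fps A) (a : A).

Lemma coefD f g n : (f + g) n = f n + g n. Proof. by []. Qed.
Lemma coefN f n : (- f) n = - f n. Proof. by []. Qed.
Lemma coefM f g n : (f * g) n = \sum_(i < n.+1) f i * g (n - i)%N.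
Proof. by []. Qed.
Lemma coef0 n : (0 : fps A) n = 0. Proof. by case: n. Qed.
Lemma coef1 n : (1 : fps A) n = (n == 0%N)%:R. Proof. by case: n. Qed.

Lemma fpsC1 : 1%:S = 1 :> fps A. Proof. by []. Qed.

Lemma coefCM a f n : (a%:S * f) n = a * f n.
Proof.
rewrite coefM big_ord_recl subn0 big1 ?addr0 // => i _.
by rewrite mul0r.
Qed.

Lemma coefM0 f g : (f * g) 0%N = f 0%N * g 0%N.
Proof. by rewrite coefM big_ord_recl big_ord0 addr0. Qed.

Lemma coefMX f n : (f * fpsX) n.+1 = f n.
Proof.
rewrite coefM big_ord_recr /= subnn mulr0 addr0 big_ord_recr /= subSnn mulr1.
rewrite big1 ?add0r // => i _; rewrite subSn ?(ltnW (ltn_ord i)) //.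
by rewrite -(subnSK (ltn_ord i)) mulr0.
Qed.

Lemma commr_fpsX f : fpsX * f = f * fpsX.
Proof.
apply: fpsP => -[|n]; first by rewrite !coefM0 mul0r mulr0.
rewrite coefMX coefM big_ord_recl mul0r add0r big_ord_recl mul1r subSS subn0.
by rewrite big1 ?addr0 // => i _; rewrite mul0r.
Qed.

Definition fps_shift f : fps A := fun n => f n.+1.

Lemma fps_shiftE f : f = (f 0%N)%:S + fps_shift f * fpsX.
Proof.
apply: fpsP => -[|n]; rewrite coefD; first by rewrite coefM0 mulr0 addr0.
by rewrite coefMX add0r.
Qed.

(** Since [h] has no constant term, [f n] and [g n] meet only the factor [h 0 = 0]. *)
Lemma eq_coefMr f g h n : h 0%N = 0 -> (forall i, (i < n)%N -> f i = g i) ->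
  (f * h) n = (g * h) n.
Proof.
move=> h0 fg; rewrite !coefM !big_ord_recr /= subnn h0 !mulr0 !addr0.
by apply: eq_bigr => i _; rewrite fg.
Qed.

Lemma coefX_small g k n : g 0%N = 0 -> (n < k)%N -> (g ^+ k) n = 0.
Proof.
move=> g0; elim: k n => // k IH n ltnk.
rewrite exprSr (eq_coefMr (g := 0)) ?mul0r ?coef0 // => i lti.
by rewrite coef0 IH // (leq_trans lti).
Qed.

(** Lets the coefficients of different orders share one truncation bound, so that double sums can be
    exchanged. *)
Lemma comp_widen f g n N : g 0%N = 0 -> (n <= N)%N ->
  (f \oS g) n = \sum_(k < N.+1) f k * (g ^+ k) n.
Proof.
move=> g0 leN; rewrite /fps_comp (big_ord_widen N.+1 (fun k => f k * (g ^+ k) n)) //.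
rewrite big_mkcond; apply: eq_bigr => k _; case: ltnP => // ltk.
by rewrite coefX_small ?mulr0.
Qed.

(* With no constant term in g, the coefficient of order n of the last product
   uses only lower coefficients of the composite; this drives every induction
   on coefficients for compositions. *)
Lemma comp_recE f g : g 0%N = 0 ->
  f \oS g = (f 0%N)%:S + (fps_shift f \oS g) * g.
Proof.
move=> g0; apply: fpsP => n; rewrite coefD coefM.
under eq_bigr => i _.
  rewrite (@comp_widen _ g i n g0) -1?ltnS ?ltn_ord // mulr_suml.
  under eq_bigr => k _ do rewrite -mulrA.
  over.
rewrite exchange_big /=.
under eq_bigr => k _ do rewrite -mulr_sumr -(coefM (g ^+ k)) -exprSr.
rewrite big_ord_recr /= coefX_small // mulr0 addr0 /fps_comp big_ord_recl.
by rewrite expr0; case: n => [|n]; rewrite ?mulr0 ?mulr1.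
Qed.

Lemma compD f1 f2 g : (f1 + f2) \oS g = (f1 \oS g) + (f2 \oS g).
Proof.
apply: fpsP => n; rewrite coefD /fps_comp -big_split /=.
by apply: eq_bigr => k _; rewrite mulrDl.
Qed.

Lemma comp_fpsC a g : a%:S \oS g = a%:S.
Proof.
apply: fpsP => n; rewrite /fps_comp big_ord_recl expr0 big1 ?addr0 => [|k _].
  by case: n => [|n]; rewrite ?mulr0 ?mulr1.
by rewrite mul0r.
Qed.

Lemma comp1 g : 1 \oS g = 1.
Proof. exact: comp_fpsC. Qed.

Lemma comp_fpsCM a f g : (a%:S * f) \oS g = a%:S * (f \oS g).
Proof.
apply: fpsP => n; rewrite coefCM /fps_comp mulr_sumr.
by apply: eq_bigr => k _; rewrite coefCM mulrA.
Qed.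

Lemma compMX f g : g 0%N = 0 -> (f * fpsX) \oS g = (f \oS g) * g.
Proof.
move=> g0; rewrite comp_recE // coefM0 mulr0 (_ : fps_shift _ = f) ?add0r //.
by apply: fpsP => n; rewrite /fps_shift coefMX.
Qed.

Lemma comp_fpsX g : g 0%N = 0 -> fpsX \oS g = g.
Proof. by move=> g0; rewrite -[fpsX]mul1r compMX // comp1 mul1r. Qed.

Lemma comp_coef0 f g : (f \oS g) 0%N = f 0%N.
Proof. by rewrite /fps_comp big_ord_recl big_ord0 expr0 mulr1 addr0. Qed.

(** Coefficients stand on the left of powers, so substituting [g] respects products once [g] can be
    moved past other series. *)
Definition fps_central g := forall h, g * h = h * g.

Lemma fps_centralP g : (forall n a, g n * a = a * g n) -> fps_central g.
Proof.
move=> cg h; apply: fpsP => n; rewrite -[g * h]/(fps_mul g h) fps_mul_rev coefM.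
by apply: eq_bigr => i _; rewrite cg.
Qed.

(** Strong induction on the order: [f1] is split into its constant term plus shift times [fpsX];
    centrality moves the resulting factor [g] to the right end, where it lowers the order. *)
Lemma compM f1 f2 g : g 0%N = 0 -> fps_central g ->
  (f1 * f2) \oS g = (f1 \oS g) * (f2 \oS g).
Proof.
move=> g0 cg; apply: fpsP => n.
elim/ltn_ind: n f1 => n IH f1.
rewrite {1}(fps_shiftE f1) mulrDl -mulrA commr_fpsX mulrA compD.
rewrite comp_fpsCM compMX // (comp_recE f1) // mulrDl -mulrA cg mulrA !coefD.
by congr (_ + _); apply: eq_coefMr => // i lti; apply: IH.
Qed.

Lemma compX f g k : g 0%N = 0 -> fps_central g ->
  (f ^+ k) \oS g = (f \oS g) ^+ k.
Proof.
move=> g0 cg; elim: k => [|k IH]; first by rewrite !expr0 comp1.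
by rewrite !exprS compM // IH.
Qed.

(** Both sides satisfy the same recursion, with last factor [g \oS h]. *)
Lemma compA f g h : g 0%N = 0 -> h 0%N = 0 -> fps_central h ->
  (f \oS g) \oS h = f \oS (g \oS h).
Proof.
move=> g0 h0 ch; have gh0 : (g \oS h) 0%N = 0 by rewrite comp_coef0.
apply: fpsP => n; elim/ltn_ind: n f => n IH f.
rewrite (comp_recE f) // compD comp_fpsC compM // (comp_recE f gh0) !coefD.
by congr (_ + _); apply: eq_coefMr => // i lti; apply: IH.
Qed.

(* The coefficient of order n of f{g} is f_1 g_n plus terms that involve only
   g_0, ..., g_(n-1). *)
Lemma comp_inj f g1 g2 : (forall a b, f 1%N * a = f 1%N * b -> a = b) ->
  g1 0%N = 0 -> g2 0%N = 0 -> f \oS g1 = f \oS g2 -> g1 = g2.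
Proof.
move=> f1_inj g10 g20 eqfg; apply: fpsP => n; elim/ltn_ind: n => n IH.
case: n IH => [|n] IH; first by rewrite g10 g20.
apply: f1_inj; have := congr1 (fun s : fps A => s n.+1) eqfg.
rewrite /fps_comp !big_ord_recl /= /bump /= !expr0 !expr1 => /addrI.
suff -> : \sum_(i < n) f (1 + (1 + i))%N * (g1 ^+ (1 + (1 + i))%N) n.+1
        = \sum_(i < n) f (1 + (1 + i))%N * (g2 ^+ (1 + (1 + i))%N) n.+1.
  by move=> /addIr.
have eqX k i : (i < n.+1)%N -> (g1 ^+ k) i = (g2 ^+ k) i.
  elim: k i => // k IHk i lti; rewrite !exprSr !coefM.
  apply: eq_bigr => j _; rewrite IHk ?IH ?(leq_ltn_trans (leq_subr _ _)) //.
  by rewrite (leq_trans (ltn_ord j)).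
(* In a power of exponent at least 2, the unknown coefficient of order [n.+1] is multiplied only by
   constant terms, which vanish. *)
apply: eq_bigr => k _; congr (_ * _); rewrite !add1n ![_ ^+ k.+2]exprSr.
rewrite (eq_coefMr (g := g2 ^+ k.+1)) //; last by move=> i; apply: eqX.
rewrite !coefM big_ord_recl [RHS]big_ord_recl /= coefX_small // !mul0r.
congr (_ + _).
by apply: eq_bigr => i _; rewrite IH // subSS ltnS leq_subr.
Qed.

End Composition.

(** * Coefficientwise image of series under a ring morphism *)

Section MapFps.
Variables (A B : pzRingType) (phi : {rmorphism A -> B}).
Implicit Types f g : fps A.

Definition map_fps f : fps B := fun n => phi (f n).

Lemma map_fpsX f k : map_fps (f ^+ k) = map_fps f ^+ k.
Proof.
elim: k => [|k IH].
  by rewrite !expr0; apply: fpsP => n; rewrite /map_fps !coef1 rmorph_nat.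
rewrite !exprS -IH; apply: fpsP => n.
by rewrite /map_fps coefM rmorph_sum; apply: eq_bigr => i _; rewrite rmorphM.
Qed.

Lemma map_fps_comp f g : map_fps (f \oS g) = map_fps f \oS map_fps g.
Proof.
apply: fpsP => n; rewrite /map_fps /fps_comp rmorph_sum.
by apply: eq_bigr => k _; rewrite rmorphM -[fun n => _]/(map_fps g) -map_fpsX.
Qed.

Lemma map_fps_fpsX : map_fps fpsX = fpsX.
Proof. by apply: fpsP => -[|[|n]]; rewrite /map_fps ?rmorph0 ?rmorph1. Qed.

End MapFps.

(** * Scalars as operators *)

Section ScalarOperators.
Variables (R : comNzRingType) (U : lmodType R).

Fact scal_op_zmod : zmod_morphism (scal_op U).
Proof. by move=> a b; apply: lendP => u; rewrite /= scalerBl. Qed.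
Fact scal_op_monoid : monoid_morphism (scal_op U).
Proof.
by split=> [|a b]; apply: lendP => u; rewrite /= ?scale1r ?scalerA.
Qed.
HB.instance Definition _ :=
  GRing.isZmodMorphism.Build R (lend U) (scal_op U) scal_op_zmod.
HB.instance Definition _ :=
  GRing.isMonoidMorphism.Build R (lend U) (scal_op U) scal_op_monoid.

(** Operators are linear, so scalar multiples of the identity commute with all of them. *)
Lemma scal_fps_central (f : fps R) : fps_central (scal_fps U f).
Proof.
by apply: fps_centralP => n T; apply: lendP => u; rewrite /= linearZ.
Qed.

End ScalarOperators.

(** * Formal differentiation over a commutative ring *)

Section Commutative.
Variable A : comPzRingType.
Implicit Types f g : fps A.

Fact fps_mulC : commutative (@fps_mul A).
Proof. by move=> f g; apply: (fps_centralP (fun n a => mulrC _ _)). Qed.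
HB.instance Definition _ :=
  GRing.PzRing_hasCommutativeMul.Build (fps A) fps_mulC.

Lemma fps_centralC f : fps_central f. Proof. by move=> g; exact: mulrC. Qed.

Lemma fpsCM (a b : A) : (a * b)%:S = a%:S * b%:S.
Proof. by apply: fpsP => -[|n]; rewrite coefCM //= mulr0. Qed.

Definition fps_deriv f : fps A := fun n => f n.+1 *+ n.+1.

Lemma derivD f g : fps_deriv (f + g) = fps_deriv f + fps_deriv g.
Proof. by apply: fpsP => n; rewrite /fps_deriv !coefD mulrnDl. Qed.
Lemma derivN f : fps_deriv (- f) = - fps_deriv f.
Proof. by apply: fpsP => n; rewrite /fps_deriv !coefN mulNrn. Qed.

Lemma derivC (a : A) : fps_deriv a%:S = 0.
Proof. by apply: fpsP => n; rewrite coef0 /fps_deriv mul0rn. Qed.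

Lemma derivX : fps_deriv fpsX = 1.
Proof. by apply: fpsP => -[|n]; rewrite coef1 /fps_deriv //= mul0rn. Qed.

Lemma derivM f g : fps_deriv (f * g) = fps_deriv f * g + f * fps_deriv g.
Proof.
apply: fpsP => n; rewrite /fps_deriv coefD !coefM -sumrMnl.
(* Leibniz rule by splitting the weight [n.+1] as [i + (n.+1 - i)] in each term. *)
have -> : \sum_(i < n.+2) f i * g (n.+1 - i)%N *+ n.+1
    = \sum_(i < n.+2) f i *+ i * g (n.+1 - i)%N
    + \sum_(i < n.+2) f i * (g (n.+1 - i)%N *+ (n.+1 - i)).
  rewrite -big_split; apply: eq_bigr => i _ /=.
  by rewrite mulrnAl mulrnAr -mulrnDr subnKC // -ltnS.
rewrite big_ord_recl mulr0n mul0r add0r; congr (_ + _).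
rewrite big_ord_recr /= subnn mulr0n mulr0 addr0.
by apply: eq_bigr => i _; rewrite subSn // -ltnS.
Qed.

Lemma deriv_comp f g : g 0%N = 0 ->
  fps_deriv (f \oS g) = (fps_deriv f \oS g) * fps_deriv g.
Proof.
move=> g0; have cg := fps_centralC g.
apply: fpsP => n; elim/ltn_ind: n f => n IH f.
rewrite (comp_recE f) // derivD derivC add0r derivM.
rewrite {3}(fps_shiftE f) derivD derivC add0r derivM derivX mulr1.
rewrite compD compMX // mulrDl mulrAC !coefD; congr (_ + _).
by apply: eq_coefMr => // i lti; apply: IH.
Qed.

End Commutative.

(** * The series sinh, cosh and asinh *)

Section RealSeries.
Variable R : realType.
Implicit Types f g : fps R.

Lemma deriv_eq0 f : fps_deriv f = 0 -> f = (f 0%N)%:S.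
Proof.
move=> f'0; apply: fpsP => -[|n] //=.
have /eqP := congr1 (fun s : fps R => s n) f'0.
by rewrite coef0 /fps_deriv mulrn_eq0 => /eqP.
Qed.

Definition cosh_fps : fps R := fun n => if odd n then 0 else (n`!%:R)^-1.

Lemma invfactS n : ((n.+1)`!%:R)^-1 *+ n.+1 = (n`!%:R)^-1 :> R.
Proof.
by rewrite -[LHS]mulr_natr factS natrM invfM mulrAC mulVf ?mul1r // pnatr_eq0.
Qed.

Lemma deriv_sinh : fps_deriv sinh_fps = cosh_fps.
Proof.
apply: fpsP => n; rewrite /fps_deriv /sinh_fps /cosh_fps oddS.
by case: odd; rewrite ?mul0rn ?invfactS.
Qed.

Lemma deriv_cosh : fps_deriv cosh_fps = sinh_fps.
Proof.
apply: fpsP => n; rewrite /fps_deriv /sinh_fps /cosh_fps oddS.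
by case: odd; rewrite ?mul0rn ?invfactS.
Qed.

Lemma sqr_cosh : cosh_fps ^+ 2 = 1 + sinh_fps ^+ 2.
Proof.
apply/eqP; rewrite -subr_eq; apply/eqP; rewrite !expr2.
have /deriv_eq0 -> : fps_deriv (cosh_fps * cosh_fps - sinh_fps * sinh_fps) = 0.
  by rewrite derivD derivN !derivM deriv_cosh deriv_sinh; ring.
by rewrite coefD coefN !coefM0 /cosh_fps /sinh_fps /= invr1 mulr0 subr0 mulr1.
Qed.

Lemma coef_deriv_asinh n : fps_deriv asinh_fps n =
  if odd n then 0 else (-1) ^+ n./2 * n`!%:R / (4 ^+ n./2 * (n./2)`!%:R ^+ 2) :> R.
Proof.
rewrite /fps_deriv /asinh_fps oddS; case: ifP => [on|]; last first.
  by move=> /negbFE ->; rewrite mul0rn.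
rewrite (negbTE on) /= uphalf_half (negbTE on) add0n -[LHS]mulr_natr.
by rewrite invfM -!mulrA mulVf ?mulr1 // pnatr_eq0.
Qed.

(** The equation (1 + z^2) A' + z A = 0 for A = asinh', read on coefficients. *)
Lemma coef_deriv_asinhSS n :
  fps_deriv asinh_fps n.+2 *+ n.+2 = - (fps_deriv asinh_fps n *+ n.+1) :> R.
Proof.
rewrite !coef_deriv_asinh !oddS negbK; case: ifP => [_|/negbT on].
  by rewrite !mul0rn oppr0.
have -> /= : n = (n./2).*2 by rewrite -[LHS]odd_double_half (negbTE on).
rewrite doubleK !factS; set m := n./2.
have mfact_neq0 : (m`!%:R : R) != 0 by rewrite pnatr_eq0 -lt0n fact_gt0.
have m1_neq0 : (m%:R + 1 : R) != 0 by rewrite natr1 pnatr_eq0.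
have pow4_neq0 : (4 ^+ m : R) != 0 by rewrite expf_neq0 // pnatr_eq0.
rewrite -[LHS]mulr_natr -[X in _ = - X]mulr_natr.
rewrite !natrM !expr2 !exprS; move: (4 ^+ m) pow4_neq0 => p p_neq0.
rewrite -!natr1 -muln2 natrM. field.
by rewrite m1_neq0 mfact_neq0 p_neq0.
Qed.

(** The Horner form lets [coefMX] and [compMX] act on each factor [fpsX]. *)
Lemma deriv_asinh_ode : let A := fps_deriv asinh_fps : fps R in
  fps_deriv A + (fps_deriv A * fpsX + A) * fpsX = 0.
Proof.
move=> A; apply: fpsP => -[|n]; rewrite coef0 coefD.
  by rewrite coefM0 mulr0 addr0 /fps_deriv /A coef_deriv_asinh mul0rn.
rewrite coefMX coefD {1}/fps_deriv coef_deriv_asinhSS -/A mulrSr.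
suff -> : (fps_deriv A * fpsX) n = A n *+ n by rewrite addNr.
by case: n => [|n]; rewrite ?coefM0 ?mulr0 ?coefMX.
Qed.

Lemma asinh_sinh : asinh_fps \oS sinh_fps = fpsX :> fps R.
Proof.
set S := sinh_fps; pose A := fps_deriv (asinh_fps : fps R).
have S0 : S 0%N = 0 by [].
have cS := fps_centralC S.
(* By cosh^2 = 1 + S^2, this derivative is cosh times the differential equation for A evaluated at
   S, up to the factor that makes the two agree: (A' o S) cosh^2 + (A o S) S. *)
have w'0 : fps_deriv ((A \oS S) * cosh_fps) = 0.
  rewrite derivM deriv_comp // deriv_sinh deriv_cosh -mulrA -expr2 sqr_cosh.
  have := congr1 (fun f => f \oS S) deriv_asinh_ode; rewrite -/A /=.
  rewrite compD compMX // compD compMX // -[0 in RHS]/(fpsC 0) comp_fpsC.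
  by move=> ode; rewrite -[RHS]/(fpsC 0) -ode -/S; ring.
(* The chain rule gives exactly the constant series above, whose value is read off at order 0. *)
have y'1 : fps_deriv (asinh_fps \oS S) = 1.
  rewrite deriv_comp // deriv_sinh (deriv_eq0 w'0) coefM0 comp_coef0.
  by rewrite /A coef_deriv_asinh /cosh_fps /= fact0; congr fpsC; field.
apply/eqP; rewrite -subr_eq0; apply/eqP.
have /deriv_eq0 -> : fps_deriv (asinh_fps \oS S - fpsX) = 0.
  by rewrite derivD derivN y'1 derivX subrr.
by rewrite coefD coefN comp_coef0 subrr.
Qed.

(** * Square root and reciprocal series *)

Lemma coef_sqrt1pS n :
  sqrt1p_fps R n.+1 *+ n.+1 = (2^-1 - n%:R) * sqrt1p_fps R n.
Proof.
rewrite /sqrt1p_fps big_ord_recr /= -mulrnAr invfactS; ring.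
Qed.

(** From 2 (1 + z) s' = s, the square q = s^2 satisfies (1 + z) q' = q. Hence (n + 1) q_(n+1) = (1 -
    n) q_n, and the factor 1 - n kills q_2 and with it all later coefficients. *)
Lemma sqrt1p_sqr : sqrt1p_fps R ^+ 2 = 1 + fpsX.
Proof.
set s := sqrt1p_fps R; set s' := fps_deriv s.
have ode : s' + s' * fpsX + (s' + s' * fpsX) = s.
  apply: fpsP => n; rewrite !coefD.
  have -> : (s' * fpsX) n = s n *+ n.
    by case: n => [|n]; rewrite ?coefM0 ?mulr0 ?coefMX.
  by rewrite /s' /fps_deriv coef_sqrt1pS -mulr_natr -/s; field.
have ode2 : fps_deriv (s ^+ 2) + fps_deriv (s ^+ 2) * fpsX = s ^+ 2.
  by rewrite !expr2 derivM -/s' -{5}ode; ring.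
have rec n : (s ^+ 2) n.+1 *+ n.+1 = (1 - n%:R) * (s ^+ 2) n.
  have := congr1 (fun f : fps R => f n) ode2; rewrite /= coefD.
  have -> : (fps_deriv (s ^+ 2) * fpsX) n = (s ^+ 2) n *+ n.
    by case: n => [|n]; rewrite ?coefM0 ?mulr0 ?coefMX.
  by move=> /(canRL (addrK _)); rewrite {1}/fps_deriv => ->; ring.
have g0 : (s ^+ 2) 0%N = 1.
  by rewrite expr2 coefM0 /s /sqrt1p_fps big_ord0 fact0 mul1r invr1 mulr1.
have g1 : (s ^+ 2) 1%N = 1 by have := rec 0%N; rewrite g0 mulr1n subr0 mulr1.
apply: fpsP => -[|[|n]]; rewrite coefD coef1 /= ?addr0 ?add0r //.
suff /eqP : (s ^+ 2) n.+2 *+ n.+2 = 0 by rewrite mulrn_eq0 => /eqP.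
rewrite rec; case: n => [|n]; first by rewrite subrr mul0r.
elim: n => [|n IH].
  suff /eqP : (s ^+ 2) 2 *+ 2 = 0 by rewrite mulrn_eq0 => /eqP ->; rewrite mulr0.
  by rewrite rec subrr mul0r.
suff /eqP : (s ^+ 2) n.+3 *+ n.+3 = 0 by rewrite mulrn_eq0 => /eqP ->; rewrite mulr0.
by rewrite rec.
Qed.

Lemma fps_sqrtK f : f 0%N = 1 -> fps_sqrt f ^+ 2 = f.
Proof.
move=> f0; have f1 : (f - 1) 0%N = 0 by rewrite coefD coefN f0 subrr.
rewrite -compX //; last exact: fps_centralC.
by rewrite sqrt1p_sqr compD comp1 comp_fpsX // addrC subrK.
Qed.

Lemma fps_sqrt1 : fps_sqrt 1 = 1 :> fps R.
Proof.
rewrite /fps_sqrt subrr comp_recE // mulr0 addr0.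
by rewrite /sqrt1p_fps big_ord0 fact0 mul1r invr1.
Qed.

Lemma inv1p_fpsE : inv1p_fps R * (1 + fpsX) = 1.
Proof.
apply: fpsP => -[|n]; rewrite mulrDr mulr1 coefD.
  by rewrite coefM0 mulr0 addr0.
by rewrite coefMX /inv1p_fps exprS mulN1r addNr.
Qed.

Lemma fps_mulfV f : f 0%N = 1 -> f * fps_inv f = 1.
Proof.
move=> f0; have f1 : (f - 1) 0%N = 0 by rewrite coefD coefN f0 subrr.
have {1}-> : f = (1 + fpsX) \oS (f - 1).
  by rewrite compD comp1 comp_fpsX // addrC subrK.
by rewrite -compM ?[_ * inv1p_fps R]mulrC ?inv1p_fpsE ?comp1 //; exact: fps_centralC.
Qed.

(** * The holistic operator at full coupling *)

(* At full coupling the fraction under the square root is identically 1. *)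
Lemma holistic_op1E (H theta : R) :
  holistic_op H 1 theta =
    (4 / H ^+ 2)%:S * (asinh_fps \oS ((2^-1)%:S * fpsX)) ^+ 2.
Proof.
rewrite /holistic_op /mu /delta fps_sqrtK; last first.
  by rewrite coefD coefCM expr2 coefM0 !mulr0 addr0.
set den := (X in fps_inv X).
have den0 : den 0%N = 1.
  by rewrite /den coefD coefN coefD !coefCM expr2 coefM0 !mulr0 oppr0 !addr0.
have -> : 1 + (4^-1)%:S * fpsX ^+ 2 - (4^-1 * theta ^+ 2)%:S * fpsX ^+ 2 = den.
  by apply: fpsP => n; rewrite /den !(coefD, coefN, coefCM); field.
by rewrite fps_mulfV // fps_sqrt1 !mul1r.
Qed.

(** Witnesses that the operator series is nonzero, which is needed to deal with the dummy value of
    [Kinv]. It comes from asinh(z/2) = z/2 + ..., squared and scaled by 4 / H^2. *)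
Lemma coef2_holistic_op1 (H theta : R) : H != 0 ->
  holistic_op H 1 theta 2%N = (H ^+ 2)^-1.
Proof.
move=> H_neq0; set h := (2^-1)%:S * fpsX : fps R.
have h0 : h 0%N = 0 by rewrite /h coefCM mulr0.
have a0 : (asinh_fps \oS h) 0%N = 0 by rewrite comp_coef0.
have a1 : (asinh_fps \oS h) 1%N = 2^-1.
  rewrite comp_recE // /h mulrA coefD coefMX mulrC coefCM comp_coef0.
  by rewrite /fps_shift /asinh_fps /= !fact0 expr0 expr1n; field.
rewrite holistic_op1E coefCM (expr2 (_ \oS _)) coefM !big_ord_recl big_ord0 /=.
rewrite -/h a0 /bump /= a1 mul0r mulr0 !addr0 add0r.
by field.
Qed.

Lemma holistic_op1_delta_x (H theta : R) : H != 0 ->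
  holistic_op H 1 theta \oS delta_x H = fpsX ^+ 2.
Proof.
move=> H_neq0; have cR := @fps_centralC R.
have hX0 : ((H / 2)%:S * fpsX : fps R) 0%N = 0 by rewrite coefCM mulr0.
have d0 : delta_x H 0%N = 0 by rewrite /delta_x coefCM comp_coef0 mulr0.
have g0 : ((2^-1)%:S * fpsX : fps R) 0%N = 0 by rewrite coefCM mulr0.
rewrite holistic_op1E comp_fpsCM compX // compA // comp_fpsCM comp_fpsX //.
(* The 1/2 inside asinh cancels the 2 of [delta_x], leaving asinh o sinh at H d_x / 2. *)
rewrite /delta_x mulrA -fpsCM mulVf ?pnatr_eq0 // fpsC1 mul1r -compA //.
rewrite asinh_sinh comp_fpsX //.
have -> : (4 / H ^+ 2)%:S * ((H / 2)%:S * fpsX) ^+ 2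
    = ((4 / H ^+ 2) * ((H / 2) * (H / 2)))%:S * fpsX ^+ 2.
  by rewrite !fpsCM; ring.
have -> : 4 / H ^+ 2 * (H / 2 * (H / 2)) = 1 by field.
by rewrite fpsC1 mul1r.
Qed.
End RealSeries.

(** * Equivalence of the two forms of the law, and consistency *)

Theorem mainTheorem15 (R : realType) (U : completeNormedModType R)
  (ip : {dot U for idfun}) (ip_norm : forall u : U, ip u u = `|u| ^+ 2)
  (K : nat -> {linear U -> U}) (K1_inv : bijective (K 1%N))
  (H : R) (H_gt0 : 0 < H) (theta : R) :
  (forall G : fps (lend U),
     holistic_T_form K H 1 theta G <-> G = holistic_rhs K H 1 theta)
  /\ consistent K H (holistic_rhs K H 1 theta).
Proof.
have H_neq0 : H != 0 by rewrite gt_eqF.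
have op0 : scal_fps U (holistic_op H 1 theta) 0%N = 0.
  rewrite holistic_op1E /scal_fps coefCM (expr2 (_ \oS _)) coefM0 comp_coef0.
  by rewrite !mulr0 (rmorph0 (scal_op U)).
have d0 : scal_fps U (delta_x H) 0%N = 0.
  by rewrite /scal_fps /delta_x coefCM comp_coef0 mulr0 (rmorph0 (scal_op U)).
split=> [G|]; last first.
  have cd := scal_fps_central (delta_x H).
  rewrite /consistent /equivalent_pde compD comp_fpsC (compA _ op0 d0 (cd _)).
  (* [scal_fps] is the image under the morphism [scal_op], so the scalar identity carries over to
     operators. *)
  rewrite -[scal_fps U _]/(map_fps (scal_op U) _).
  rewrite -[scal_fps U _]/(map_fps (scal_op U) _).
  by rewrite -map_fps_comp (holistic_op1_delta_x _ H_neq0) map_fpsX map_fps_fpsX.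
split=> [|->].
  rewrite /holistic_T_form /Kinv; case: xgetP => [r _ [_ KrG] r_op|_ op_eq0].
    by rewrite /holistic_rhs -r_op KrG addrC subrK.
  (* Here Kinv returns its dummy value 0, which the nonzero operator on the
     other side can equal only if U = 0. *)
  suff U_triv (u : U) : u = 0.
    by apply: fpsP => n; apply: lendP => u; rewrite (U_triv (G n u)) [RHS]U_triv.
  have := congr1 (fun f : fps (lend U) => f 2%N u) op_eq0.
  rewrite /scal_fps coef2_holistic_op1 // coef0 /= => /esym /eqP.
  by rewrite scaler_eq0 invr_eq0 expf_eq0 (negbTE H_neq0) => /eqP.
(* The holistic operator solves the equation defining [Kinv]; injectivity of K_1 makes it the only
   solution. *)
rewrite /holistic_T_form /Kinv /holistic_rhs addrC addKr.
apply: xget_unique => // r [r0]; apply: comp_inj => // a b ab.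
apply: lendP => u; apply: (bij_inj K1_inv).
exact: (congr1 (fun f : lend U => f u) ab).
Qed.
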